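(* Any pyramid with its apex chopped off is not coherently labellable. In particular, the triangular prism and the cube or the cuboid are not coherently labellable.
   Context: A pyramid is the convex polyhedron obtained by joining every vertex of a convex $n$-gon ($n\ge 3$) to a point (the apex) outside its plane. Chopping off the apex means cutting the pyramid by a plane that separates the apex from all the other vertices, crossing the interiors of exactly the edges incident to the apex, and discarding the piece containing the apex; the result has the faces of the truncated pyramid, including the newly created $n$-gon. For a convex polyhedron, each face $F$ is oriented by the outward normal, so its boundary edges are traversed anticlockwise as seen from outside. A labelling of all the edges by integers is coherent if, for each face $F$ with $n_F$ edges, there is a choice of starting edge such that the successive labels read anticlockwise from that edge satisfy $a_1<a_2<\cdots<a_{n_F}$. The polyhedron is coherently labellable if it has a coherent labelling. *)

(* Defs.v *)
From mathcomp Require Import all_boot all_order all_algebra.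
From mathcomp Require Import classical_sets reals convex.

Set Implicit Arguments.
Unset Strict Implicit.
Unset Printing Implicit Defensive.

Import Order.TTheory GRing.Theory Num.Theory.
Local Open Scope classical_set_scope.
Local Open Scope ring_scope.

Notation vec3 R := 'rV[R]_3.

Definition dot (R : realType) (u v : vec3 R) : R := (u *m v^T) 0 0.

(* The indices k + 1 and k + 2 are taken modulo 3, in 'I_3 = 'Z_3. *)
Definition cross (R : realType) (u v : vec3 R) : vec3 R :=
  \row_(k < 3) (u 0 (k + 1) * v 0 (k + 2) - u 0 (k + 2) * v 0 (k + 1)).

Definition hull (R : realType) (A : set (vec3 R)) : set (vec3 R) :=
  smallest (@convex_set R (vec3 R)) A.

(* [v 0, ..., v (n - 1)] are the vertices of a convex n-gon lying in a plane
   with normal vector [m], listed anticlockwise as seen from the side to which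
   [m] points: every vertex not on the side from [v i] to its cyclic successor
   [v (ordS i)] is strictly to the left of that side. *)
Definition convex_ngon (R : realType) (n : nat) (m : vec3 R)
    (v : 'I_n -> vec3 R) : Prop :=
  [/\ (2 < n)%N,
      forall i j, dot m (v i) = dot m (v j) &
      forall i j, j != i -> j != ordS i ->
        0 < dot m (cross (v (ordS i) - v i) (v j - v i))].

Definition ngon_side (R : realType) (n : nat) (v : 'I_n -> vec3 R)
    (i : 'I_n) : set (vec3 R) := hull [set v i; v (ordS i)].

(* [F] is a (two-dimensional) face of [P] with outward normal vector [m]. *)
Definition face (R : realType) (P : set (vec3 R)) (m : vec3 R)
    (F : set (vec3 R)) : Prop :=
  [/\ m != 0,
      exists2 c : R, (forall x, P x -> dot m x <= c) &
                     F = P `&` [set x | dot m x = c] &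
      exists x y z, [/\ F x, F y, F z & cross (y - x) (z - x) != 0]].

(* The edges of a polyhedron are the sides of its faces, seen as sets of
   points, so that the two faces meeting along an edge see the same label.
   Only the values of [lab] at the edges matter.  The n-gon [v] lists the
   vertices of the face [F] anticlockwise as seen from outside, and the choice
   of the starting edge is that of [v 0]. *)
Definition coherent_labelling (R : realType) (P : set (vec3 R))
    (lab : set (vec3 R) -> int) : Prop :=
  forall m F, face P m F ->
    exists (n : nat) (v : 'I_n -> vec3 R),
      [/\ convex_ngon m v, F = hull (range v) &
          forall i j : 'I_n, (i < j)%N ->
            lab (ngon_side v i) < lab (ngon_side v j)].

Definition coherently_labellable (R : realType) (P : set (vec3 R)) : Prop :=
  exists lab : set (vec3 R) -> int, coherent_labelling P lab.

Definition pyramid (R : realType) (n : nat) (v : 'I_n -> vec3 R)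
    (apex : vec3 R) : set (vec3 R) := hull (range v `|` [set apex]).

(* The plane [dot h x = d] cuts [P]; the piece on the side [d < dot h x] is
   discarded. *)
Definition chop (R : realType) (P : set (vec3 R)) (h : vec3 R) (d : R) :
  set (vec3 R) := P `&` [set x | dot h x <= d].

Definition prism (R : realType) (n : nat) (v : 'I_n -> vec3 R)
    (t : vec3 R) : set (vec3 R) :=
  hull (range v `|` range (fun i => v i + t)).

Definition box (R : realType) (o a b c : vec3 R) : set (vec3 R) :=
  [set p | exists x y z : R, [/\ 0 <= x <= 1, 0 <= y <= 1, 0 <= z <= 1 &
                              p = o + x *: a + y *: b + z *: c]].

Definition is_cuboid (R : realType) (P : set (vec3 R)) : Prop :=
  exists o a b c : vec3 R,
    [/\ a != 0, b != 0 & c != 0] /\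
    [/\ dot a b = 0, dot b c = 0, dot a c = 0 & P = box o a b c].

Definition is_cube (R : realType) (P : set (vec3 R)) : Prop :=
  exists o a b c : vec3 R,
    [/\ a != 0, dot a a = dot b b & dot b b = dot c c] /\
    [/\ dot a b = 0, dot b c = 0, dot a c = 0 & P = box o a b c].

(* Main.v *)
Require Import Defs.
From mathcomp Require Import all_boot all_order all_algebra.
From mathcomp Require Import classical_sets reals convex.
From mathcomp Require Import boolp interval_inference ring lra.

Set Implicit Arguments.
Unset Strict Implicit.
Unset Printing Implicit Defensive.

Import Order.TTheory GRing.Theory Num.Theory.
Local Open Scope classical_set_scope.
Local Open Scope ring_scope.

(** A labelled polyhedron has at most as many vertices as facets, provided that
    its vertices are simple: this is the obstruction.  Three edges with
    neighbours x0, x1, x2 meet at a simple vertex p, any two consecutive ones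
    being sides of one facet.  With a suitable cyclic order, the facet with the
    sides x0 p x1 is traversed from x1 to p to x0, the next one from x2 to p to
    x1 and the last one from x0 to p to x2.  If none of them were read from p,
    the label would increase at each of these three corners, so that the label
    of the first edge would be less than itself.  Hence p is the starting point
    of the reading of some facet; as a facet has one starting point only, the
    vertices inject into the facets ([card_vertices_le_facets]).

    A truncated pyramid and a prism over an n-gon have 2n vertices, all simple,
    for n + 2 facets, and 2n > n + 2 if n > 2 ([prism_type_not_labellable]).

    The geometric part consists in recognizing the facets.  The polyhedra are
    hulls of finite families of points, with known supporting planes, and a
    supporting plane cuts a hull in the hull of the generators that it contains
    ([hull_face]).  A coherent labelling comes with some convex polygon spanning
    each facet; the lemma [ngon_corner] shows that near a vertex of the
    polyhedron it runs along the expected edges.  The truncated pyramid is the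
    hull of its base and of the points where the plane meets the lateral edges
    ([chop_pyramid]), and a cuboid is a prism ([box_prism]). *)

(** * Dot and cross products *)

Lemma dotE (R : realType) (u v : vec3 R) :
  dot u v = u 0 0 * v 0 0 + u 0 1 * v 0 1 + u 0 2 * v 0 2.
Proof.
rewrite /dot mxE !big_ord_recr big_ord0 /= add0r !mxE.
by congr (_ * _ + _ * _ + _ * _); congr (_ _ _); apply/val_inj.
Qed.

Lemma crossE (R : realType) (u v : vec3 R) :
  (cross u v 0 0 = u 0 1 * v 0 2 - u 0 2 * v 0 1) *
  (cross u v 0 1 = u 0 2 * v 0 0 - u 0 0 * v 0 2) *
  (cross u v 0 2 = u 0 0 * v 0 1 - u 0 1 * v 0 0).
Proof.
by split; [split|]; rewrite mxE; congr (_ * _ - _ * _); congr (_ _ _);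
  apply/val_inj.
Qed.

(* Identities between dot and cross products, checked on coordinates. *)
Ltac vring := rewrite ?(dotE, crossE, mxE); ring.

Section DotTheory.
Variable R : realType.
Implicit Types (u v w m : vec3 R) (a : R).

Lemma vec3P u v : u 0 0 = v 0 0 -> u 0 1 = v 0 1 -> u 0 2 = v 0 2 -> u = v.
Proof.
move=> e0 e1 e2; apply/rowP => -[[|[|[|k]]] lt3] //.
- by rewrite (_ : Ordinal lt3 = 0) //; apply/val_inj.
- by rewrite (_ : Ordinal lt3 = 1) //; apply/val_inj.
- by rewrite (_ : Ordinal lt3 = 2) //; apply/val_inj.
Qed.

Lemma dotC u v : dot u v = dot v u. Proof. vring. Qed.
Lemma dotDr u v w : dot u (v + w) = dot u v + dot u w. Proof. vring. Qed.
Lemma dotBr u v w : dot u (v - w) = dot u v - dot u w. Proof. vring. Qed.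
Lemma dotZr u a v : dot u (a *: v) = a * dot u v. Proof. vring. Qed.
Lemma dotZl u a v : dot (a *: u) v = a * dot u v. Proof. vring. Qed.
Lemma dotNr u v : dot u (- v) = - dot u v. Proof. vring. Qed.
Lemma dotNl u v : dot (- u) v = - dot u v. Proof. vring. Qed.
Lemma dot0r u : dot u 0 = 0. Proof. vring. Qed.

Lemma crossC u v : cross v u = - cross u v.
Proof. by apply: vec3P; vring. Qed.

Lemma dot_crossA m u v : dot m (cross u v) = dot (cross m u) v.
Proof. vring. Qed.

Lemma dot_ge0 u : 0 <= dot u u.
Proof. by rewrite dotE !addr_ge0 // -expr2 sqr_ge0. Qed.

Lemma dot_eq0 u : (dot u u == 0) = (u == 0).
Proof.
apply/idP/eqP => [|->]; last by rewrite dot0r.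
rewrite dotE !paddr_eq0 ?addr_ge0 -?expr2 ?sqr_ge0 // !sqrf_eq0.
by move=> /andP[/andP[/eqP e0 /eqP e1] /eqP e2]; apply: vec3P; rewrite !mxE.
Qed.

Lemma dot_gt0 u : (0 < dot u u) = (u != 0).
Proof. by rewrite lt_neqAle dot_ge0 andbT eq_sym dot_eq0. Qed.

End DotTheory.

(** * Convex hulls *)

Section Hull.
Variable R : realType.
Implicit Types (A B : set (vec3 R)) (m p q x y : vec3 R) (c a : R).

(** The library's convexity with an explicit real coefficient. *)
Lemma convex_setP A : @convex_set R (vec3 R) A <->
  forall x y a, A x -> A y -> 0 <= a <= 1 -> A (a *: x + (1 - a) *: y).
Proof.
split=> [cA x y a Ax Ay /andP[a0 a1]|cA x y l].
  have /(_ (Itv01 a0 a1)) := cA x y _ (mem_set Ax) (mem_set Ay).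
  by rewrite inE.
rewrite !inE => Ax Ay; apply: (cA x y l%:num) => //.
by apply/andP; split; [exact: ge0 | exact: le1].
Qed.

Lemma hull_convex A x y a :
  hull A x -> hull A y -> 0 <= a <= 1 -> hull A (a *: x + (1 - a) *: y).
Proof.
by move=> hx hy ha B [cB AB]; apply: ((convex_setP B).1 cB) => //;
  [apply: hx | apply: hy].
Qed.

Lemma sub_hull A : A `<=` hull A. Proof. exact: sub_gen_smallest. Qed.

Lemma hull_sub A B :
  (forall x y a, B x -> B y -> 0 <= a <= 1 -> B (a *: x + (1 - a) *: y)) ->
  A `<=` B -> hull A `<=` B.
Proof. by move=> /(convex_setP B) cB; apply: smallest_sub. Qed.

Lemma hullS A B : A `<=` hull B -> hull A `<=` hull B.
Proof. by apply: hull_sub; apply: hull_convex. Qed.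

Lemma hull_set0 : hull (set0 : set (vec3 R)) = set0.
Proof. by apply/seteqP; split=> //; apply: hull_sub. Qed.

Lemma hull2 p q x : hull [set p; q] x ->
  exists2 a, 0 <= a <= 1 & x = p + a *: (q - p).
Proof.
move: x; apply: hull_sub => [x y a|x [] ->]; last 2 first.
- by exists 0; rewrite ?lexx ?ler01 // scale0r addr0.
- by exists 1; rewrite ?lexx ?ler01 // scale1r addrC subrK.
move=> [b /andP[b0 b1] ->] [c /andP[c0 c1] ->] /andP[a0 a1].
exists (a * b + (1 - a) * c); first by apply/andP; split; nra.
by apply: vec3P; vring.
Qed.

Lemma hull_le A m c : (forall x, A x -> dot m x <= c) ->
  forall x, hull A x -> dot m x <= c.
Proof.
move=> Ac; apply: (@hull_sub A [set x | dot m x <= c]) => //= x y a.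
by move=> hx hy /andP[a0 a1]; rewrite dotDr !dotZr; nra.
Qed.

(** A supporting plane cuts a convex hull in the hull of the generators that
    it contains. *)
Lemma hull_face A m c x : (forall y, A y -> dot m y <= c) ->
  hull A x -> dot m x = c -> hull (A `&` [set y | dot m y = c]) x.
Proof.
move=> Ac Ax mx.
suff: (dot m x <= c /\ (dot m x = c -> hull (A `&` [set y | dot m y = c]) x)).
  by case=> _; apply.
move: x Ax {mx}; apply: hull_sub => [x y a|x Ax]; last first.
  by split=> [|mx]; [exact: Ac | apply: sub_hull].
move=> [lex hx] [ley hy] /andP[a0 a1]; rewrite dotDr !dotZr; split; first nra.
move=> e.
have [a00|an0] := eqVneq a 0.
  by move: e; rewrite a00 subr0 mul0r mul1r !scale0r !scale1r !add0r.
have [a11|an1] := eqVneq a 1.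
  by move: e; rewrite a11 subrr mul0r mul1r !scale0r !scale1r !addr0.
have {}a0 : 0 < a by rewrite lt_neqAle eq_sym an0.
have {}a1 : a < 1 by rewrite lt_neqAle an1.
apply: hull_convex; [apply: hx; nra | apply: hy; nra |].
by rewrite !ltW.
Qed.

End Hull.

(** * Corners of polygons *)

Section Corner.
Variable R : realType.
Implicit Types (u z m p q r x : vec3 R) (c a : R).

Lemma hull_eq (A : set (vec3 R)) m c : (forall x, A x -> dot m x = c) ->
  forall x, hull A x -> dot m x = c.
Proof.
move=> Ac x hx; apply/le_anti/andP; split.
  by apply: (hull_le _ hx) => y /Ac ->.
rewrite -lerN2 -dotNl; apply: (hull_le _ hx) => y /Ac <-.
by rewrite dotNl.
Qed.

(** In the plane orthogonal to [m], let the wedge spanned by [u] and [u'] be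
    cut out along [u] by the half-plane [dot M z <= 0].  A vector [z] of this
    half-plane that is not strictly to the left of [u] lies on the line of
    [u]. *)
Lemma planar_wedge (m M u u' z : vec3 R) :
  dot m u = 0 -> dot m u' = 0 -> dot m z = 0 ->
  0 < dot m (cross u u') -> dot M u = 0 -> dot M u' < 0 ->
  dot M z <= 0 -> 0 <= dot m (cross z u) -> dot M z = 0.
Proof.
move=> mu mu' mz D0 Mu Mu' Mz zu.
have m0 : 0 < dot m m.
  rewrite dot_gt0; apply: contraTneq D0 => ->.
  by rewrite dotC dot0r ltxx.
have /eqP : dot m m * dot z (cross u u') = 0.
  transitivity (dot m z * dot m (cross u u') + dot m u * dot m (cross u' z) +
    dot m u' * dot m (cross z u)); first by vring.
  by rewrite mu mu' mz !mul0r !addr0.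
rewrite mulf_eq0 gt_eqF //= => /eqP det0.
have e : dot M z * dot m (cross u u') = - (dot m (cross z u) * dot M u').
  transitivity (dot m (cross z u') * dot M u + dot m (cross u z) * dot M u' +
     dot z (cross u u') * dot M m); first by vring.
  by rewrite Mu det0 mulr0 mul0r add0r addr0 (crossC z u) dotNr mulNr.
nra.
Qed.

(** Let the supporting plane with normal [M] meet the polygon [v] in the segment
    from the vertex [p = v k] to [r], the polygon being to the left of that
    segment with respect to [m], as witnessed by [q].  If the polygon is also to
    the left of the segment from [v k] to [v l], and meets its line only at
    these two vertices, then [v l] is [r].  As [m] may be either of the two
    normals of the polygon, this describes both neighbours of [v k]. *)
Lemma ngon_neighbour n (v : 'I_n -> vec3 R) (k l : 'I_n) (m M p q r : vec3 R)
    c :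
  (forall j, dot m (v j) = dot m (v k)) ->
  (forall j, 0 <= dot m (cross (v l - v k) (v j - v k))) ->
  (forall j, dot m (cross (v l - v k) (v j - v k)) = 0 -> j = k \/ j = l) ->
  v k = p -> hull (range v) r -> hull (range v) q ->
  (forall x, hull (range v) x -> dot M x <= c) ->
  (forall x, hull (range v) x -> dot M x = c -> hull [set p; r] x) ->
  dot M p = c -> dot M r = c -> dot M q < c ->
  0 < dot m (cross (r - p) (q - p)) -> v l = r.
Proof.
move=> mv left left0 vk hr hq leM eqM Mp Mr Mq D0.
have mh x : hull (range v) x -> dot m x = dot m p.
  by apply: hull_eq => _ [j _ <-]; rewrite mv vk.
have vh j : hull (range v) (v j) by apply: sub_hull; exists j.
have hp : hull (range v) p by rewrite -vk.
pose N := - cross m (v l - p).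
have NE x : dot N x = dot N p - dot m (cross (v l - p) (x - p)).
  by rewrite /N !dotNl dot_crossA dotBr; ring.
have N0 x : dot N x = dot N p -> dot m (cross (v l - p) (x - p)) = 0.
  by rewrite NE; lra.
have Nle x : hull (range v) x -> dot N x <= dot N p.
  apply: hull_le => _ [j _ <-]; rewrite NE lerBlDr lerDl -vk.
  exact: left.
have Mvl : dot M (v l) = c.
  suff : dot M (v l - p) = 0 by rewrite dotBr Mp; lra.
  apply: (@planar_wedge m M (r - p) (q - p)) => //; rewrite ?dotBr.
  - by rewrite (mh r) // subrr.
  - by rewrite (mh q) // subrr.
  - by rewrite (mh (v l)) // subrr.
  - by rewrite Mp Mr subrr.
  - by rewrite Mp subr_lt0.
  - by rewrite Mp subr_le0 leM.
  - by have := Nle r hr; rewrite NE; lra.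
have [a /andP[a0 a1] vlE] := hull2 (eqM _ (vh l) Mvl).
have Nr : dot N r = dot N p.
  by rewrite NE vlE; apply/eqP; rewrite subr_eq addrC -subr_eq subrr; apply/eqP;
    vring.
have [|b /andP[b0 b1] rE] := @hull2 R p (v l) r.
  apply: hullS (hull_face _ hr Nr) => [|_ [j _ <-]]; last exact: Nle.
  move=> _ [[j _ <-] /= /N0]; rewrite -vk => /left0[] ->; apply: sub_hull.
  - by left.
  - by right.
have rp : r - p != 0.
  by rewrite subr_eq0; apply: contraTneq D0 => ->; rewrite (_ : dot _ _ = 0)
    ?ltxx //; vring.
have /eqP : (1 - b * a) *: (r - p) = 0.
  rewrite scalerBl scale1r -scalerA.
  have -> : a *: (r - p) = v l - p by rewrite vlE addrAC subrr add0r.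
  by rewrite {1}rE (addrC p) addrK subrr.
rewrite scaler_eq0 (negPf rp) orbF => /eqP ab.
have -> : v l = p + 1 *: (r - p) by rewrite vlE; congr (_ + _ *: _); nra.
by rewrite scale1r addrC subrK.
Qed.

(** If the convex polygon [v] has a corner at [p] with outgoing side [[p, r]]
    and incoming side [[q, p]], then these are consecutive sides of [v]. *)
Lemma ngon_corner n (v : 'I_n -> vec3 R) (m M M' p q r : vec3 R) c c' :
  convex_ngon m v ->
  hull (range v) p -> hull (range v) r -> hull (range v) q ->
  (forall x, hull (range v) x -> dot M x <= c) ->
  (forall x, hull (range v) x -> dot M x = c -> hull [set p; r] x) ->
  (forall x, hull (range v) x -> dot M' x <= c') ->
  (forall x, hull (range v) x -> dot M' x = c' -> hull [set p; q] x) ->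
  dot M p = c -> dot M r = c -> dot M q < c ->
  dot M' p = c' -> dot M' q = c' -> dot M' r < c' ->
  0 < dot m (cross (r - p) (q - p)) ->
  exists k, [/\ v k = p, v (ordS k) = r & v (ord_pred k) = q].
Proof.
move=> [n2 mv left] hp hr hq leM eqM leM' eqM' Mp Mr Mq M'p M'q M'r D0.
have [k vk] : exists k, v k = p.
  have vh y : range v y -> hull (range v) y by apply: sub_hull.
  pose A := range v `&` [set x | dot M x = c].
  have hA : hull A p by apply: hull_face => // y /vh /leM.
  have {hA} : hull (A `&` [set x | dot M' x = c']) p.
    by apply: hull_face => // y [/vh /leM'].
  apply: contraPP => nk; suff -> : A `&` [set x | dot M' x = c'] = set0.
    by rewrite hull_set0.
  rewrite -subset0 /A => y [[[k _ vk] /= My] M'y].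
  case: nk; exists k; have hy : hull (range v) y by apply: vh; exists k.
  have [a _ yE] := hull2 (eqM y hy My).
  have a0 : a = 0 by move: M'y; rewrite yE dotDr dotZr dotBr M'p; nra.
  by rewrite vk yE a0 scale0r addr0.
have eq_ge0 (x : R) : x = 0 -> 0 <= x by move=> ->.
exists k; split=> //.
- apply: (@ngon_neighbour _ v k (ordS k) m M p q r c) => // j.
  + have [->|jk] := eqVneq j k; first by apply: eq_ge0; vring.
    have [->|jl] := eqVneq j (ordS k); first by apply: eq_ge0; vring.
    by rewrite ltW ?left.
  + have [->|jk] := eqVneq j k; first by left.
    have [->|jl] := eqVneq j (ordS k); first by right.
    by have := left _ _ jk jl => /gt_eqF + /eqP => ->.
- have swap j : dot (- m) (cross (v (ord_pred k) - v k) (v j - v k)) =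
      dot m (cross (v k - v (ord_pred k)) (v j - v (ord_pred k))) by vring.
  apply: (@ngon_neighbour _ v k (ord_pred k) (- m) M' p r q c') => // [j|j|j|].
  + by rewrite !dotNl (mv j k).
  + rewrite swap; have [->|jk] := eqVneq j k; first by apply: eq_ge0; vring.
    have [->|jl] := eqVneq j (ord_pred k); first by apply: eq_ge0; vring.
    by rewrite ltW // -[in X in X - _](ord_predK k) left ?ord_predK.
  + rewrite swap; have [->|jk] := eqVneq j k; first by left.
    have [->|jl] := eqVneq j (ord_pred k); first by right.
    have := left _ _ jl; rewrite ord_predK => /(_ jk).
    by move=> /gt_eqF + /eqP => ->.
  + by rewrite dotNl crossC dotNr opprK.
Qed.

End Corner.

(** * Simple vertices of labelled polyhedra *)

(** For the incidence relation [inc] between facets and vertices, three facets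
    [g0], [g1], [g2] and three neighbours [x0], [x1], [x2] surround the vertex
    [i]: going around cyclically, [ga] contains [xa] and its successor but not
    the third neighbour, and two of these facets share no vertex but [i] and one
    neighbour. *)
Definition simple_vertex (V F : Type) (inc : F -> V -> bool) (i : V) : Prop :=
  exists (x0 x1 x2 : V) (g0 g1 g2 : F),
  [/\ [/\ inc g0 i, inc g0 x0, inc g0 x1 & ~~ inc g0 x2],
      [/\ inc g1 i, inc g1 x1, inc g1 x2 & ~~ inc g1 x0],
      [/\ inc g2 i, inc g2 x2, inc g2 x0 & ~~ inc g2 x1] &
      forall j, [/\ inc g0 j -> inc g1 j -> j = i \/ j = x1,
                    inc g1 j -> inc g2 j -> j = i \/ j = x2 &
                    inc g2 j -> inc g0 j -> j = i \/ j = x0]].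

Section Orientation.
Variable R : realType.
Implicit Types u m : vec3 R.

(** Three vectors dual to three others up to nonzero factors are linearly
    independent. *)
Lemma simple_cone_det u0 u1 u2 m0 m1 m2 :
  dot m0 u0 = 0 -> dot m0 u1 = 0 -> dot m0 u2 < 0 ->
  dot m1 u1 = 0 -> dot m1 u2 = 0 -> dot m1 u0 < 0 ->
  dot m2 u2 = 0 -> dot m2 u0 = 0 -> dot m2 u1 < 0 ->
  dot u2 (cross u0 u1) != 0.
Proof.
move=> e00 e01 l02 e11 e12 l10 e22 e20 l21; apply/eqP => D0.
have : dot m0 u2 * dot m1 u0 * dot m2 u1 = 0.
  transitivity (dot m2 (cross m0 m1) * dot u2 (cross u0 u1)); last first.
    by rewrite D0 mulr0.
  (* Cauchy-Binet for the matrix of the products [dot ma ub]. *)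
  transitivity (
    dot m0 u0 * (dot m1 u1 * dot m2 u2 - dot m1 u2 * dot m2 u1) -
    dot m0 u1 * (dot m1 u0 * dot m2 u2 - dot m1 u2 * dot m2 u0) +
    dot m0 u2 * (dot m1 u0 * dot m2 u1 - dot m1 u1 * dot m2 u0)).
    by rewrite e00 e01 e11; ring.
  by vring.
by apply/eqP; rewrite !mulf_neq0 // lt_eqF.
Qed.

(** A facet through the directions [u0] and [u1] with outward normal [m] is
    traversed from [u0] to [u1] or backwards according to the orientation of
    the edge directions only. *)
Lemma corner_orientation u0 u1 u2 m :
  dot m u0 = 0 -> dot m u1 = 0 -> dot m u2 < 0 ->
  dot u2 (cross u0 u1) != 0 ->
  dot m (cross u0 u1) * dot u2 (cross u0 u1) < 0.
Proof.
move=> e0 e1 l2 D0.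
have -> : dot m (cross u0 u1) * dot u2 (cross u0 u1) =
    dot m u2 * dot (cross u0 u1) (cross u0 u1).
  transitivity (dot m u2 * dot (cross u0 u1) (cross u0 u1) +
    dot m u0 * dot (cross u1 u2) (cross u0 u1) +
    dot m u1 * dot (cross u2 u0) (cross u0 u1)); first by vring.
  by rewrite e0 e1 !mul0r !addr0.
rewrite pmulr_llt0 // dot_gt0; apply: contraNneq D0 => ->.
by rewrite dot0r.
Qed.

End Orientation.

Section Counting.
Variables (R : realType) (V F : finType).
Variables (w : V -> vec3 R) (m : F -> vec3 R) (c : F -> R).
Variable inc : F -> V -> bool.
Hypothesis w_le : forall g i, dot (m g) (w i) <= c g.
Hypothesis w_eq : forall g i, (dot (m g) (w i) == c g) = inc g i.

Let P : set (vec3 R) := hull (range w).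
Let facet g : set (vec3 R) := P `&` [set x | dot (m g) x = c g].

Let incP g i : inc g i -> dot (m g) (w i) = c g.
Proof. by rewrite -w_eq => /eqP. Qed.

Let nincP g i : ~~ inc g i -> dot (m g) (w i) < c g.
Proof. by rewrite -w_eq lt_neqAle w_le andbT. Qed.

Let P_le g x : P x -> dot (m g) x <= c g.
Proof. by apply: hull_le => _ [i _ <-]. Qed.

Let facetw g i : inc g i -> facet g (w i).
Proof.
move=> gi; split; last exact: incP.
by apply: sub_hull; exists i.
Qed.

Let facet_face g i r q : inc g i -> inc g r -> inc g q ->
  0 < dot (m g) (cross (w r - w i) (w q - w i)) -> face P (m g) (facet g).
Proof.
move=> gi gr gq D0; split; first 1 last.
- by exists (c g) => //; apply: P_le.
- exists (w i), (w r), (w q); split; try exact: facetw.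
  by apply: contraTneq D0 => ->; rewrite dot0r ltxx.
- by apply: contraTneq D0 => ->; rewrite dotC dot0r ltxx.
Qed.

Let facet_edge g g' i r : (forall j, inc g j -> inc g' j -> j = i \/ j = r) ->
  forall x, facet g x -> dot (m g') x = c g' -> hull [set w i; w r] x.
Proof.
move=> gg' x [Px gx] g'x.
pose A := range w `&` [set x | dot (m g) x = c g].
have hA : hull A x by apply: hull_face => // _ [i' _ <-].
have {hA} : hull (A `&` [set x | dot (m g') x = c g']) x.
  by apply: hull_face => // _ [[i' _ <-] _].
apply: hullS => _ [[[j _ <-] /= /eqP + ] /eqP].
by rewrite !w_eq => gj g'j; apply: sub_hull; case: (gg' j gj g'j) => ->;
  [left | right].
Qed.

(** At a corner of a coherently labelled facet, the labels increase from the
    incoming side to the outgoing side, unless the reading starts there. *)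
Let corner_label (lab : set (vec3 R) -> int) n (v : 'I_n -> vec3 R)
    g g' g'' i r q :
  convex_ngon (m g) v -> facet g = hull (range v) ->
  (forall a b : 'I_n, (a < b)%N -> lab (ngon_side v a) < lab (ngon_side v b)) ->
  [/\ inc g i, inc g r & inc g q] -> [/\ inc g' i, inc g' r & ~~ inc g' q] ->
  [/\ inc g'' i, inc g'' q & ~~ inc g'' r] ->
  (forall j, inc g j -> inc g' j -> j = i \/ j = r) ->
  (forall j, inc g j -> inc g'' j -> j = i \/ j = q) ->
  0 < dot (m g) (cross (w r - w i) (w q - w i)) ->
  (exists2 k : 'I_n, k = 0%N :> nat & v k = w i) \/
  lab (hull [set w i; w q]) < lab (hull [set w i; w r]).
Proof.
move=> cv Fv labv [gi gr gq] [g'i g'r g'q] [g''i g''q g''r] er eq D0.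
have [k [vk vS vp]] : exists k, [/\ v k = w i, v (ordS k) = w r &
    v (ord_pred k) = w q].
  apply: (ngon_corner (M := m g') (M' := m g'') (c := c g') (c' := c g'') cv);
    rewrite -?Fv //; try (by exact: facetw || exact: incP || exact: nincP).
  - by move=> x [/P_le].
  - exact: facet_edge.
  - by move=> x [/P_le].
  - exact: facet_edge.
have [k0|k0] := eqVneq (val k) 0%N; [by left; exists k | right].
have : (ord_pred k < k)%N.
  have [k' kE] : exists k', k = k'.+1 :> nat.
    by exists (val k).-1; rewrite prednK ?lt0n.
  have := ltn_ord k; rewrite /= kE addSn /= modnDr => /ltnW kn.
  by rewrite modn_small.
by move/labv; rewrite /ngon_side ord_predK vk vS vp setUC.
Qed.

Variable lab : set (vec3 R) -> int.
Hypothesis lab_coherent : coherent_labelling P lab.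

(** If no facet were read from the vertex [i], then the labels of the three
    edges at [i] would increase cyclically. *)
Let vertex_start (start : F -> vec3 R) i x0 x1 x2 g0 g1 g2 :
  (forall g, face P (m g) (facet g) -> exists n (v : 'I_n -> vec3 R),
     [/\ convex_ngon (m g) v, facet g = hull (range v),
         forall a b : 'I_n, (a < b)%N ->
           lab (ngon_side v a) < lab (ngon_side v b) &
         forall k : 'I_n, k = 0%N :> nat -> v k = start g]) ->
  [/\ inc g0 i, inc g0 x0, inc g0 x1 & ~~ inc g0 x2] ->
  [/\ inc g1 i, inc g1 x1, inc g1 x2 & ~~ inc g1 x0] ->
  [/\ inc g2 i, inc g2 x2, inc g2 x0 & ~~ inc g2 x1] ->
  (forall j, [/\ inc g0 j -> inc g1 j -> j = i \/ j = x1,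
                 inc g1 j -> inc g2 j -> j = i \/ j = x2 &
                 inc g2 j -> inc g0 j -> j = i \/ j = x0]) ->
  0 < dot (m g0) (cross (w x0 - w i) (w x1 - w i)) ->
  0 < dot (m g1) (cross (w x1 - w i) (w x2 - w i)) ->
  0 < dot (m g2) (cross (w x2 - w i) (w x0 - w i)) ->
  exists g, start g = w i.
Proof.
move=> startP [i0 a0 b0 c0] [i1 a1 b1 c1] [i2 a2 b2 c2] meet D0 D1 D2.
have step g g' g'' r q :
    [/\ inc g i, inc g r & inc g q] -> [/\ inc g' i, inc g' r & ~~ inc g' q] ->
    [/\ inc g'' i, inc g'' q & ~~ inc g'' r] ->
    (forall j, inc g j -> inc g' j -> j = i \/ j = r) ->
    (forall j, inc g j -> inc g'' j -> j = i \/ j = q) ->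
    0 < dot (m g) (cross (w r - w i) (w q - w i)) ->
    start g = w i \/ lab (hull [set w i; w q]) < lab (hull [set w i; w r]).
  move=> gP g'P g''P er eq D.
  have [gi gr gq] := gP.
  have [n [v [cv Fv labv v0]]] := startP g (facet_face gi gr gq D).
  have [[k k0 <-]|?] :=
    corner_label cv Fv labv gP g'P g''P er eq D; last by right.
  by left; rewrite v0.
have [|||j gj g'j|j gj g'j|//|s0|l0] := step g0 g2 g1 x0 x1; try by split.
- by case: (meet j) => _ _ /(_ g'j gj).
- by case: (meet j) => /(_ gj g'j).
- by exists g0.
have [|||j gj g'j|j gj g'j|//|s1|l1] := step g1 g0 g2 x1 x2; try by split.
- by case: (meet j) => /(_ g'j gj).
- by case: (meet j) => _ /(_ gj g'j).
- by exists g1.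
have [|||j gj g'j|j gj g'j|//|s2|l2] := step g2 g1 g0 x2 x0; try by split.
- by case: (meet j) => _ /(_ g'j gj).
- by case: (meet j) => _ _ /(_ gj g'j).
- by exists g2.
by have := lt_trans (lt_trans l0 l2) l1; rewrite ltxx.
Qed.

Hypothesis simple : forall i, simple_vertex inc i.

Let w_inj : injective w.
Proof.
move=> i j wij.
have [x0 [x1 [x2 [g0 [g1 [g2 [[i0 _ _ _] [i1 _ _ _] [i2 _ _ n2] meet]]]]]]] :=
  simple i.
have same g : inc g i -> inc g j by rewrite -!w_eq wij.
case: (meet j) => /(_ (same _ i0) (same _ i1)) [-> //|jx] _ _.
by move: n2; rewrite -jx same.
Qed.

Lemma card_vertices_le_facets : (#|V| <= #|F|)%N.
Proof.
have /choice [start startP] : forall g, exists s,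
    face P (m g) (facet g) -> exists n (v : 'I_n -> vec3 R),
     [/\ convex_ngon (m g) v, facet g = hull (range v),
         forall a b : 'I_n, (a < b)%N ->
           lab (ngon_side v a) < lab (ngon_side v b) &
         forall k : 'I_n, k = 0%N :> nat -> v k = s].
  move=> g; have [Fg|nF] := pselect (face P (m g) (facet g)); last by exists 0.
  have [n [v [cv Fv labv]]] := lab_coherent Fg.
  have n0 : (0 < n)%N by case: cv => n2 _ _; apply: leq_trans n2.
  exists (v (Ordinal n0)) => _; exists n, v; split=> // k k0.
  by congr v; apply/val_inj.
suff /choice [h hP] : forall i, exists g, start g = w i.
  by apply: (@leq_card _ _ h) => i j hij; apply: w_inj; rewrite -!hP hij.
move=> i.
have [x0 [x1 [x2 [g0 [g1 [g2 [G0 G1 G2 meet]]]]]]] := simple i.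
have [i0 a0 b0 c0] := G0; have [i1 a1 b1 c1] := G1; have [i2 a2 b2 c2] := G2.
have dot0 g j : inc g i -> inc g j -> dot (m g) (w j - w i) = 0.
  by move=> gi gj; rewrite dotBr !incP // subrr.
have dot_lt0 g j : inc g i -> ~~ inc g j -> dot (m g) (w j - w i) < 0.
  by move=> gi gj; rewrite dotBr (incP gi) subr_lt0 nincP.
have D := simple_cone_det (dot0 _ _ i0 a0) (dot0 _ _ i0 b0) (dot_lt0 _ _ i0 c0)
  (dot0 _ _ i1 a1) (dot0 _ _ i1 b1) (dot_lt0 _ _ i1 c1)
  (dot0 _ _ i2 a2) (dot0 _ _ i2 b2) (dot_lt0 _ _ i2 c2).
set d := dot _ _ in D.
have d1 : d = dot (w x0 - w i) (cross (w x1 - w i) (w x2 - w i)).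
  by rewrite /d; vring.
have d2 : d = dot (w x1 - w i) (cross (w x2 - w i) (w x0 - w i)).
  by rewrite /d; vring.
have := corner_orientation (dot0 _ _ i0 a0) (dot0 _ _ i0 b0)
  (dot_lt0 _ _ i0 c0) D.
have := corner_orientation (dot0 _ _ i1 a1) (dot0 _ _ i1 b1)
  (dot_lt0 _ _ i1 c1).
have := corner_orientation (dot0 _ _ i2 a2) (dot0 _ _ i2 b2)
  (dot_lt0 _ _ i2 c2).
rewrite -/d -d1 -d2 => /(_ D) O2 /(_ D) O1 O0.
have [dneg|dpos] : d < 0 \/ 0 < d by apply/orP; rewrite -neq_lt.
  rewrite !(nmulr_llt0 _ dneg) in O0 O1 O2.
  exact: vertex_start startP G0 G1 G2 meet O0 O1 O2.
(* The other orientation amounts to swapping two neighbours. *)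
rewrite !(pmulr_llt0 _ dpos) in O0 O1 O2.
have rev g r q : dot (m g) (cross r q) < 0 -> 0 < dot (m g) (cross q r).
  by rewrite crossC dotNr oppr_lt0.
apply: (vertex_start startP (i := i) (x0 := x0) (x1 := x2) (x2 := x1)
  (g0 := g2) (g1 := g1) (g2 := g0)); rewrite ?rev //.
move=> j; case: (meet j) => m01 m12 m20.
by split=> ga gb; [apply: m12 | apply: m01 | apply: m20].
Qed.

End Counting.

(** * Polyhedra with the combinatorial type of a prism *)

(** The incidence relation of the prism over an n-gon.  The vertices are
    [(s, j)], where [s] tells the top from the bottom; the facets are the two
    bases [inl s] and the lateral facets [inr i], where [inr i] contains the
    vertices numbered [i] and [ordS i] of both bases. *)
Definition prism_inc n (g : bool + 'I_n) (p : bool * 'I_n) : bool :=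
  match g with
  | inl s => p.1 == s
  | inr i => (p.2 == i) || (p.2 == ordS i)
  end.

Lemma ordS_neq n (i : 'I_n) : (1 < n)%N -> ordS i != i.
Proof.
move=> n1; rewrite -val_eqE /=; have i_lt := ltn_ord i.
have [iS|iS] := eqVneq i.+1 n; last first.
  by rewrite modn_small ?gtn_eqF // ltn_neqAle iS.
rewrite iS modnn; apply: contraTneq n1 => i0.
by rewrite -iS -i0.
Qed.

Lemma ordSS_neq n (i : 'I_n) : (2 < n)%N -> ordS (ordS i) != i.
Proof.
move=> n2; rewrite -val_eqE /= -addn1 modnDml addn1.
apply: contraTneq n2 => e; rewrite -leqNgt.
have : (i.+2 == i %[mod n])%N by rewrite e modn_small.
by rewrite -[X in _ == X %[mod _]]addn0 -addn2 eqn_modDl mod0n => /dvdn_leq ->.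
Qed.

Lemma prism_inc_simple n p : (2 < n)%N -> simple_vertex (@prism_inc n) p.
Proof.
move=> n2; case: p => s i; have n1 := ltnW n2.
have SN := ordS_neq _ n1; have SSN := fun j => ordSS_neq j n2.
set j := ord_pred i; have ij : i = ordS j by rewrite ord_predK.
have nsS : ~~ s != s by case: s.
exists (s, j), (s, ordS i), (~~ s, i), (inl s), (inr i), (inr j).
rewrite /prism_inc /= ij !eqxx !orbT (negPf nsS) (negPf (SSN j)).
rewrite (eq_sym j) (negPf (SN j)) (eq_sym j) (negPf (SSN j)) (negPf (SN _)).
split=> // -[s' k] /=; split=> [/eqP -> /orP[] /eqP ->||].
- by left.
- by right.
- move=> /orP[] /eqP -> /orP[] /eqP.
  + by move/eqP; rewrite (negPf (SN j)).
  + by move=> _; case: s {nsS} s' => [] []; [left | right | right | left].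
  + by move/eqP; rewrite (negPf (SSN j)).
  + by move/eqP; rewrite (negPf (SN _)).
- by move=> /orP[] /eqP -> /eqP ->; [right | left].
Qed.

Section PrismType.
Variable R : realType.
Implicit Types (m h N t a : vec3 R) (c d : R).

(** The bases [v] and [t], in planes with normals [N] and [h] and joined by
    lateral facets with normals [M i], have together 2n vertices, for n + 2
    facets. *)
Lemma prism_type_not_labellable n (v t : 'I_n -> vec3 R)
    (M : 'I_n -> vec3 R) (C : 'I_n -> R) N c h d :
  (2 < n)%N ->
  (forall i j, if (j == i) || (j == ordS i) then dot (M i) (v j) = C i
               else dot (M i) (v j) < C i) ->
  (forall i j, if (j == i) || (j == ordS i) then dot (M i) (t j) = C i
               else dot (M i) (t j) < C i) ->
  (forall j, dot N (v j) = c) -> (forall j, dot N (t j) < c) ->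
  (forall j, dot h (t j) = d) -> (forall j, dot h (v j) < d) ->
  ~ coherently_labellable (hull (range v `|` range t)).
Proof.
move=> n2 Mv Mt Nv Nt ht hv [lab].
pose w (p : bool * 'I_n) := if p.1 then t p.2 else v p.2.
pose m (g : bool + 'I_n) :=
  match g with inl s => if s then h else N | inr i => M i end.
pose C' (g : bool + 'I_n) :=
  match g with inl s => if s then d else c | inr i => C i end.
have wP g p : if prism_inc g p then dot (m g) (w p) = C' g
              else dot (m g) (w p) < C' g.
  case: g p => [[]|i] [[] j] /=;
    [exact: ht|exact: hv|exact: Nt|exact: Nv|exact: Mt|exact: Mv].
have -> : range v `|` range t = range w.
  apply/seteqP; split=> [x [] [j _ <-]|_ [[[] j] _ <-]].
  - by exists (false, j).
  - by exists (true, j).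
  - by right; exists j.
  - by left; exists j.
have le_w g p : dot (m g) (w p) <= C' g.
  by have := wP g p; case: ifP => _ => [->|/ltW].
have eq_w g p : (dot (m g) (w p) == C' g) = prism_inc g p.
  by have := wP g p; case: ifP => _ => [->|/lt_eqF //]; rewrite eqxx.
move=> lab_c.
have := card_vertices_le_facets le_w eq_w lab_c
  (fun p => prism_inc_simple p n2).
rewrite card_prod card_sum card_bool card_ord.
by rewrite mul2n -addnn leq_add2r leqNgt n2.
Qed.

End PrismType.

(** * Truncated pyramids, prisms and cuboids *)

Section Polyhedra.
Variable R : realType.
Implicit Types (m h N t a b c o : vec3 R) (d : R).

(** Through each side of a convex polygon passes a plane parallel to a given
    direction [a], if [a] is not parallel to the polygon.  This plane supports
    the polygon exactly along that side. *)
Lemma ngon_side_plane n (v : 'I_n -> vec3 R) m a (i : 'I_n) :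
  convex_ngon m v -> dot m a != 0 ->
  exists M, dot M a = 0 /\
    forall j, if (j == i) || (j == ordS i) then dot M (v j) = dot M (v i)
              else dot M (v j) < dot M (v i).
Proof.
move=> [n2 mv left] ma.
pose L := - cross m (v (ordS i) - v i).
have LE j : dot L (v j - v i) = - dot m (cross (v (ordS i) - v i) (v j - v i)).
  by rewrite dotNl dot_crossA.
pose M := L - (dot L a / dot m a) *: m.
have ME x : dot M x = dot L x - dot L a / dot m a * dot m x.
  by rewrite /M; vring.
exists M; split=> [|j]; first by rewrite ME divfK // subrr.
rewrite !ME (mv j i); case: ifPn => [|]; last first.
  rewrite negb_or => /andP[ji jS]; have := left _ _ ji jS.
  by rewrite -oppr_lt0 -LE dotBr subr_lt0 ltrD2r.
by move=> /orP[] /eqP -> //; congr (_ - _); apply/eqP; rewrite -subr_eq0 -dotBr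
  LE; apply/eqP; vring.
Qed.

Lemma prism_not_labellable n (v : 'I_n -> vec3 R) m t :
  convex_ngon m v -> dot m t != 0 -> ~ coherently_labellable (prism v t).
Proof.
move=> cv mt; have [n2 mv _] := cv.
have j0 : 'I_n by exact: Ordinal (ltnW (ltnW n2)).
have mt2 : 0 < dot m t * dot m t.
  by rewrite -expr2 lt_neqAle eq_sym sqrf_eq0 mt sqr_ge0.
have /choice [M MP] := fun i => ngon_side_plane i cv mt.
apply: (@prism_type_not_labellable R n v (fun i => v i + t) M
  (fun i => dot (M i) (v i)) (- dot m t *: m) (- dot m t * dot m (v j0))
  (dot m t *: m) (dot m t * (dot m (v j0) + dot m t))) => // [i|i j|j|j|j|j].
- by have [_] := MP i.
- by have [Mt /(_ j)] := MP i; rewrite dotDr Mt addr0.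
- by rewrite dotZl (mv j j0).
- by rewrite dotZl dotDr (mv j j0); nra.
- by rewrite dotZl dotDr (mv j j0).
- by rewrite dotZl (mv j j0); nra.
Qed.

(** Rays from [a]: if the generators of [hull A] are on rays from [a] through
    [hull B], so are all its points. *)
Lemma hull_cone (A B : set (vec3 R)) a :
  (forall x, A x -> exists r z, [/\ 0 <= r, hull B z & x = a + r *: (z - a)]) ->
  forall x, hull A x ->
    exists r z, [/\ 0 <= r, hull B z & x = a + r *: (z - a)].
Proof.
move=> AB; apply: hull_sub => // x y e [r [z [r0 hz ->]]] [s [z' [s0 hz' ->]]].
move=> /andP[e0 e1].
have [q0|q0] := eqVneq (e * r + (1 - e) * s) 0.
  have /andP[/eqP er /eqP es] : (e * r == 0) && ((1 - e) * s == 0).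
    by rewrite -paddr_eq0 ?mulr_ge0 ?subr_ge0 // q0.
  exists 0, z; split=> //.
  rewrite !scalerDr !scalerA er es !scale0r !addr0 -scalerDl.
  by rewrite addrCA subrr addr0 scale1r.
have qpos : 0 < e * r + (1 - e) * s.
  by rewrite lt_neqAle eq_sym q0 addr_ge0 ?mulr_ge0 ?subr_ge0.
pose f := e * r / (e * r + (1 - e) * s).
exists (e * r + (1 - e) * s), (f *: z + (1 - f) *: z'); split; first exact: ltW.
  apply: hull_convex => //; rewrite /f ler_pdivlMr // mul0r.
  by rewrite ler_pdivrMr // mul1r mulr_ge0 // lerDl mulr_ge0 ?subr_ge0.
have fE : (e * r + (1 - e) * s) * f = e * r by rewrite mulrC divfK.
apply/eqP; rewrite -subr_eq0; apply/eqP.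
transitivity ((e * r - (e * r + (1 - e) * s) * f) *: (z - z')).
  by apply: vec3P; vring.
by rewrite fE subrr scale0r.
Qed.

Lemma hull_ray (A : set (vec3 R)) a u (r s : R) :
  hull A (a + r *: u) -> hull A (a + u) -> r <= s <= 1 -> hull A (a + s *: u).
Proof.
move=> hr h1 /andP[rs s1].
have [r1|r1] := eqVneq r 1.
  by have -> : s = 1 by [lra]; rewrite scale1r.
have r1' : 0 < 1 - r by rewrite subr_gt0 lt_neqAle r1 (le_trans rs).
pose e := (1 - s) / (1 - r).
have eE : e * (1 - r) = 1 - s by rewrite divfK // gt_eqF.
have -> : a + s *: u = e *: (a + r *: u) + (1 - e) *: (a + u).
  have -> : s = 1 - e * (1 - r) by rewrite eE; ring.
  by apply: vec3P; vring.
apply: hull_convex => //; rewrite /e ler_pdivlMr // mul0r ler_pdivrMr // mul1r.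
by apply/andP; split; lra.
Qed.

(** Cutting off the apex leaves the hull of the base [v] and of the points [t]
    where the cutting plane meets the lateral edges. *)
Lemma chop_pyramid n (v t : 'I_n -> vec3 R) (l : 'I_n -> R) (N a h : vec3 R)
    (k d : R) :
  (forall j, t j = a + l j *: (v j - a)) -> (forall j, 0 < l j < 1) ->
  (forall j, dot N (v j) = k) -> dot N a < k ->
  (forall j, dot h (t j) = d) -> (forall j, dot h (v j) < d) -> d < dot h a ->
  'I_n -> chop (pyramid v a) h d = hull (range v `|` range t).
Proof.
move=> tE l01 Nv Na ht hv ha j0; apply/seteqP; split=> [x [px hx]|]; last first.
  pose A := range v `|` [set a]; have hA j : hull A (v j).
    by apply: sub_hull; left; exists j.
  move=> x xK; split.
    apply: hullS xK => _ [|] [j _ <-]; first exact: hA.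
    rewrite tE; have /andP[l0 l1] := l01 j.
    apply: (@hull_ray _ a (v j - a) 0); rewrite ?ltW //.
    - by rewrite scale0r addr0; apply: sub_hull; right.
    - by rewrite addrC subrK.
  apply: hull_le xK => _ [|] [j _ <-]; first exact: ltW.
  by rewrite ht.
have [r [z [r0 hz xE]]] : exists r z,
    [/\ 0 <= r, hull (range t) z & x = a + r *: (z - a)].
  apply: hull_cone px => _ [[j _ <-]|->]; last first.
    exists 0, (t j0); split=> //; first by apply: sub_hull; exists j0.
    by rewrite scale0r addr0.
  have /andP[l0 l1] := l01 j.
  exists (l j)^-1, (t j); rewrite invr_ge0 ltW //; split=> //.
    by apply: sub_hull; exists j.
  by rewrite tE addrAC subrr add0r scalerA mulVf ?gt_eqF // scale1r addrC subrK.
have [s [y [s0 hy zE]]] : exists s y,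
    [/\ 0 <= s, hull (range v) y & z = a + s *: (y - a)].
  apply: hull_cone hz => _ [j _ <-]; have /andP[l0 l1] := l01 j.
  exists (l j), (v j); rewrite tE ltW //; split=> //.
  by apply: sub_hull; exists j.
have xy : x = a + (r * s) *: (y - a).
  by rewrite xE zE addrAC subrr add0r scalerA.
have hhz : dot h z = d by apply: hull_eq hz => _ [j _ <-].
have Ny : dot N y = k by apply: hull_eq hy => _ [j _ <-].
have Nx : dot N x <= k.
  by apply: hull_le px => _ [[j _ <-]|->]; [rewrite Nv | rewrite ltW].
have r1 : 1 <= r.
  by move: hx => /=; rewrite xE dotDr dotZr dotBr hhz; nra.
have rs1 : r * s <= 1.
  by move: Nx; rewrite xy dotDr dotZr dotBr Ny; nra.
rewrite xy; apply: (@hull_ray _ _ _ s); last by apply/andP; split=> //; nra.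
- rewrite -zE; apply: hullS hz => _ [j _ <-].
  by apply: sub_hull; right; exists j.
- rewrite addrC subrK; apply: hullS hy => _ [j _ <-].
  by apply: sub_hull; left; exists j.
Qed.

Lemma chopped_pyramid_not_labellable n (v : 'I_n -> vec3 R) m a h d :
  convex_ngon m v -> (forall i, dot m a != dot m (v i)) ->
  d < dot h a -> (forall i, dot h (v i) < d) ->
  ~ coherently_labellable (chop (pyramid v a) h d).
Proof.
move=> cv ma ha hv; have [n2 mv _] := cv.
have j0 : 'I_n by exact: Ordinal (ltnW (ltnW n2)).
have mav j : dot m (a - v j) != 0 by rewrite dotBr subr_eq0.
have /choice [M MP] := fun i => ngon_side_plane i cv (mav i).
have Ma i : dot (M i) a = dot (M i) (v i).
  by apply/eqP; rewrite -subr_eq0 -dotBr; have [->] := MP i.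
pose l j := (dot h a - d) / (dot h a - dot h (v j)).
have hav j : 0 < dot h a - dot h (v j) by rewrite subr_gt0 (lt_trans (hv j)).
have lE j : l j * (dot h a - dot h (v j)) = dot h a - d.
  by rewrite divfK ?gt_eqF.
have l01 j : 0 < l j < 1.
  apply/andP; split; first by rewrite divr_gt0 // subr_gt0.
  by rewrite ltr_pdivrMr // mul1r ltrD2l ltrN2.
pose t j := a + l j *: (v j - a).
have tE N j : dot N (t j) = dot N a + l j * (dot N (v j) - dot N a).
  by rewrite dotDr dotZr dotBr.
(* The outward normal of the base. *)
pose N := - dot m (a - v j0) *: m; pose k := dot N (v j0).
have Nv j : dot N (v j) = k by rewrite /k !dotZl (mv j j0).
have Na : dot N a < k.
  rewrite -subr_lt0 /k -dotBr dotZl mulNr oppr_lt0 -expr2 lt_neqAle eq_sym.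
  by rewrite sqrf_eq0 mav sqr_ge0.
have ht j : dot h (t j) = d by rewrite tE; have := lE j; lra.
rewrite (chop_pyramid (t := t) (l := l) (N := N) (k := k)) //.
apply: (@prism_type_not_labellable R n v t M (fun i => dot (M i) (v i)) N k h d)
  => // [i|i j|j].
- by have [_] := MP i.
- have [_ /(_ j)] := MP i; have /andP[l0 l1] := l01 j; rewrite tE Ma.
  by case: ifP => _ => [->|Mv]; [rewrite subrr mulr0 addr0 | nra].
- by rewrite tE Nv; have /andP[l0 l1] := l01 j; nra.
Qed.

(** A parallelepiped is a prism over a parallelogram. *)
Definition parallelogram o a b (i : 'I_4) : vec3 R :=
  nth o [:: o; o + a; o + a + b; o + b] i.

Lemma parallelogram_convex o a b : cross a b != 0 ->
  convex_ngon (cross a b) (parallelogram o a b).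
Proof.
move=> ab0; have D : 0 < dot (cross a b) (cross a b) by rewrite dot_gt0.
split=> // [i j|i j].
  suff dotk k : dot (cross a b) (parallelogram o a b k) = dot (cross a b) o.
    by rewrite !dotk.
  by case: k => [[|[|[|[|]]]]] //= ?; rewrite /parallelogram /=; vring.
have S k : parallelogram o a b (ordS k) =
    nth o [:: o + a; o + a + b; o + b; o] k.
  by case: k => [[|[|[|[|]]]]] //= ?.
rewrite !S -!val_eqE.
case: i j => [[|[|[|[|]]]]] // ? [[|[|[|[|]]]]] // ? _ _;
  rewrite /parallelogram /=; apply: lt_le_trans D _;
  rewrite le_eqVlt; apply/orP; left; apply/eqP; by vring.
Qed.

Lemma box_prism o a b c : box o a b c = prism (parallelogram o a b) c.
Proof.
apply/seteqP; split=> [_ [x [y [z [x01 y01 z01 ->]]]]|].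
  pose A : set (vec3 R) := range (parallelogram o a b) `|`
    range (fun i => parallelogram o a b i + c).
  have base s : s = 0 \/ s = c -> hull A (o + x *: a + y *: b + s).
    move=> sc; have hA i : hull A (parallelogram o a b i + s).
      by case: sc => ->; apply: sub_hull; [left; exists i; rewrite ?addr0
        | right; exists i].
    have hA0 := hA (@Ordinal 4 0 isT); have hA1 := hA (@Ordinal 4 1 isT).
    have hA2 := hA (@Ordinal 4 2 isT); have hA3 := hA (@Ordinal 4 3 isT).
    have := hull_convex (hull_convex hA2 hA3 x01) (hull_convex hA1 hA0 x01) y01.
    by congr (hull A _); rewrite /parallelogram /=; apply: vec3P; vring.
  have := hull_convex (base c (or_intror erefl)) (base 0 (or_introl erefl)) z01.
  by congr (hull A _); apply: vec3P; vring.
have i0 : 0 <= (0 : R) <= 1 by rewrite lexx ler01.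
have i1 : 0 <= (1 : R) <= 1 by rewrite lexx ler01.
apply: hull_sub => [u u' e [x [y [z [x01 y01 z01 ->]]]]|_ [|] [i _ <-]].
- move=> [x' [y' [z' [x01' y01' z01' ->]]]] e01.
  exists (e * x + (1 - e) * x'), (e * y + (1 - e) * y'), (e * z + (1 - e) * z').
  have mix p q : 0 <= p <= 1 -> 0 <= q <= 1 -> 0 <= e * p + (1 - e) * q <= 1.
    by move: e01 => /andP[? ?] /andP[? ?] /andP[? ?]; apply/andP; split; nra.
  by split; try exact: mix; apply: vec3P; vring.
- case: i => [[|[|[|[|]]]]] //= ?; rewrite /parallelogram /=.
  + by exists 0, 0, 0; split=> //; apply: vec3P; vring.
  + by exists 1, 0, 0; split=> //; apply: vec3P; vring.
  + by exists 1, 1, 0; split=> //; apply: vec3P; vring.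
  + by exists 0, 1, 0; split=> //; apply: vec3P; vring.
- case: i => [[|[|[|[|]]]]] //= ?; rewrite /parallelogram /=.
  + by exists 0, 0, 1; split=> //; apply: vec3P; vring.
  + by exists 1, 0, 1; split=> //; apply: vec3P; vring.
  + by exists 1, 1, 1; split=> //; apply: vec3P; vring.
  + by exists 0, 1, 1; split=> //; apply: vec3P; vring.
Qed.

Lemma cuboid_not_labellable (P : set (vec3 R)) :
  is_cuboid P -> ~ coherently_labellable P.
Proof.
move=> [o [a [b [c [[a0 b0 c0] [ab bc ac ->]]]]]]; rewrite box_prism.
have aa : 0 < dot a a by rewrite dot_gt0.
have bb : 0 < dot b b by rewrite dot_gt0.
have cc : 0 < dot c c by rewrite dot_gt0.
have abc : dot (cross a b) c != 0.
  rewrite -sqrf_eq0.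
  (* The Gram determinant of three orthogonal vectors. *)
  have -> : dot (cross a b) c ^+ 2 = dot a a * dot b b * dot c c.
    transitivity (dot a a * dot b b * dot c c +
      2 * dot a b * dot b c * dot a c - dot a a * dot b c ^+ 2 -
      dot b b * dot a c ^+ 2 - dot c c * dot a b ^+ 2); first by vring.
    by rewrite ab bc ac; ring.
  by rewrite gt_eqF // !mulr_gt0.
have ab0 : cross a b != 0 by apply: contraNneq abc => ->; rewrite dotC dot0r.
exact: prism_not_labellable (parallelogram_convex o ab0) abc.
Qed.

Lemma cube_cuboid (P : set (vec3 R)) : is_cube P -> is_cuboid P.
Proof.
move=> [o [a [b [c [[a0 eab ebc] H]]]]]; exists o, a, b, c; split=> //.
by split=> //; rewrite -dot_eq0 -?ebc -?eab dot_eq0.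
Qed.

End Polyhedra.

Theorem theorem7p10 (R : realType) :
  (* a pyramid over the convex n-gon v, with its apex chopped off by a plane
     separating the apex from all the vertices of the base *)
  (forall (n : nat) (v : 'I_n -> vec3 R) (m apex h : vec3 R) (d : R),
     convex_ngon m v ->
     (forall i, dot m apex != dot m (v i)) ->
     d < dot h apex ->
     (forall i, dot h (v i) < d) ->
     ~ coherently_labellable (chop (pyramid v apex) h d)) /\
  (* triangular prisms *)
  (forall (v : 'I_3 -> vec3 R) (m t : vec3 R),
     convex_ngon m v -> dot m t != 0 ->
     ~ coherently_labellable (prism v t)) /\
  (forall P : set (vec3 R), is_cube P -> ~ coherently_labellable P) /\
  (forall P : set (vec3 R), is_cuboid P -> ~ coherently_labellable P).
Proof.
split; [|split; [|split]].
- by move=> n v m apex h d; apply: chopped_pyramid_not_labellable.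
- by move=> v m t; apply: prism_not_labellable.
- by move=> P /cube_cuboid; apply: cuboid_not_labellable.
- by move=> P; apply: cuboid_not_labellable.
Qed.
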